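(* Let $(G=(V,E),L,c,r,e_r)$ be a rooted WRAP instance and let $\vec F\subseteq V\times V$ be a non-shortenable directed WRAP solution of it. Then: (i) $(V,\vec F)$ is an arborescence rooted at $r$; (ii) $\vec F$ is $G$-planar; (iii) for every $v\in V$, no two directed links of $\delta^+_{\vec F}(v)$ go in the same direction, i.e., $\delta^+_{\vec F}(v)$ contains at most one left-going and at most one right-going link.
   Context: Rooted WRAP instance: a cycle $G=(V,E)$, links $L\subseteq\binom V2$, costs $c\colon L\to\mathbb R_{\ge0}$, root $r\in V$, edge $e_r\in E$ incident to $r$. $\mathcal C_G=\{C\subseteq V\setminus\{r\}:|\delta_E(C)|=2\}$. A directed link $(u,v)$ ($u\ne v$) covers $C\in\mathcal C_G$ if $v\in C$, $u\notin C$. A directed WRAP solution is $\vec F\subseteq V\times V$ such that each $C\in\mathcal C_G$ is entered by a link of $\vec F$. A shortening of $(u,v)$ is $(s,v)$ with $s\ne v$ on the $u$-$v$ path in the path $(V,E\setminus\{e_r\})$; strict if $s\ne u$. $\vec F$ is non-shortenable if deleting any link or replacing any link by a strict shortening destroys the directed-solution property. Two pairs $\{a,b\},\{x,y\}$ of vertices cross if they share no endpoint and each of the two paths of $G$ between $a$ and $b$ contains one of $x,y$; a set of (directed, orientation ignored) links is $G$-planar if no two of its members cross. Number $V=\{r=v_0,\dots,v_{n-1}\}$ along the path $(V,E\setminus\{e_r\})$ starting at $r$; $(v_i,v_j)$ is left-going if $i>j$ and right-going if $i<j$. $\delta^+_{\vec F}(v)$ is the set of links of $\vec F$ with tail $v$.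 *)

(* Defs.v *)
From HB Require Import structures.
From mathcomp Require Import all_boot all_order all_algebra.
From mathcomp Require Import reals.

Set Implicit Arguments.
Unset Strict Implicit.
Unset Printing Implicit Defensive.

(* Undirected multigraphs, given by ends : E -> {set V}, so that the cycle on
   two vertices (two parallel edges) is covered. *)
Section Multigraph.
Variables (V E : finType) (ends : E -> {set V}).

Definition is_cycle : Prop :=
  exists (n : nat) (v : 'I_n -> V) (e : 'I_n -> E),
    [/\ 2 <= n, bijective v, bijective e
      & forall i, ends (e i) = [set v i; v (ordS i)]].

Definition cut (C : {set V}) : {set E} :=
  [set e | (ends e :&: C != set0) && (ends e :\: C != set0)].

Definition adj (D : {set E}) : rel V :=
  fun x y => [exists e in D, ends e == [set x; y]].

(* x :: p is the vertex sequence of an x-y path in (V, D). *)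
Definition is_path (D : {set E}) (x : V) (p : seq V) (y : V) : bool :=
  [&& path (adj D) x p, last x p == y & uniq (x :: p)].

Definition cross (a b x y : V) : Prop :=
  [disjoint [set a; b] & [set x; y]]
  /\ forall p, is_path [set: E] a p b -> (x \in a :: p) || (y \in a :: p).

(* Directed links are ordered pairs (tail, head). *)
Definition planar (F : {set V * V}) : Prop :=
  forall f g, f \in F -> g \in F -> ~ cross f.1 f.2 g.1 g.2.

End Multigraph.

Definition is_arborescence (V : finType) (F : {set V * V}) (r : V) : Prop :=
  [/\ #|[set f in F | f.2 == r]| = 0,
      forall v, v != r -> #|[set f in F | f.2 == v]| = 1
    & forall v, connect (fun x y => (x, y) \in F) r v].

Record rooted_wrap (R : realType) := RootedWrap {
  vertex : finType;
  edge : finType;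
  ends : edge -> {set vertex};
  links : {set {set vertex}};
  cost : {l : {set vertex} | l \in links} -> R;
  root_vertex : vertex;
  root_edge : edge;
  ends_cycle : is_cycle ends;
  card_link : forall l, l \in links -> #|l| = 2;
  cost_ge0 : forall l, (0 <= cost l)%R;
  root_edge_incident : root_vertex \in ends root_edge
}.

Arguments ends {R} _ _.

Section Wrap.
Variables (R : realType) (I : rooted_wrap R).
Local Notation V := (vertex I).

Definition min_cuts : {set {set V}} :=
  [set C : {set V} | (C \subset [set~ root_vertex I]) && (#|cut (ends I) C| == 2)].

Definition covers (f : V * V) (C : {set V}) : bool :=
  (f.2 \in C) && (f.1 \notin C).

Definition directed_solution (F : {set V * V}) : Prop :=
  forall C, C \in min_cuts -> exists2 f, f \in F & covers f C.

(* (V, E \ {e_r}) is itself a path, so the u-v path p below is unique. *)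
Definition shortening (f g : V * V) : Prop :=
  [/\ g.2 = f.2, g.1 != g.2
    & exists2 p, is_path (ends I) [set~ root_edge I] f.1 p f.2
               & g.1 \in f.1 :: p].

Definition strict_shortening (f g : V * V) : Prop :=
  shortening f g /\ g.1 != f.1.

Definition non_shortenable (F : {set V * V}) : Prop :=
  [/\ directed_solution F,
      forall f, f \in F -> ~ directed_solution (F :\ f)
    & forall f g, f \in F -> strict_shortening f g ->
        ~ directed_solution (g |: (F :\ f))].

(* s = [:: v_0; ...; v_(n-1)] lists V along the path (V, E \ {e_r}), with
   v_0 = r; thus v = v_i where i = index v s. *)
Definition numbering (s : seq V) : Prop :=
  [/\ ohead s = Some (root_vertex I), sorted (adj (ends I) [set~ root_edge I]) s,
      uniq s & forall v, v \in s].

Definition left_going (s : seq V) (f : V * V) : bool :=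
  index f.2 s < index f.1 s.

Definition right_going (s : seq V) (f : V * V) : bool :=
  index f.1 s < index f.2 s.

Definition out_links (F : {set V * V}) (v : V) : {set V * V} :=
  [set f in F | f.1 == v].

Lemma numbering_exists : exists s, numbering s.
Proof.
have [n [v [e [n2 bv [e' eK e'K] endsE]]]] := ends_cycle I.
have n0 : 0 < n by apply: leq_trans n2.
pose o i := Ordinal (ltn_pmod i n0); pose w i := v (o i).
pose k := e' (root_edge I).
have oE (i : 'I_n) : o i = i by apply: val_inj; rewrite /= modn_small.
have [v' vK v'K] := bv.
have winj i j : i < n -> j < n -> forall a, w (a + i) = w (a + j) -> i = j.
  move=> li lj a /(bij_inj bv) [] /eqP; rewrite eqn_modDl !modn_small //.
  by move/eqP.
have adjw j : k < j < k + n ->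
    adj (ends I) [set~ root_edge I] (w j) (w j.+1).
  case/andP=> kj jk; apply/existsP; exists (e (o j)); rewrite !inE endsE.
  have -> : ordS (o j) = o j.+1.
    by apply: val_inj; rewrite /= -addn1 modnDml addn1.
  rewrite eqxx andbT -(e'K (root_edge I)) -/k (inj_eq (can_inj eK)).
  apply/eqP=> ojk; have ljk : j - k < n by rewrite -(ltn_add2l k) subnKC // ltnW.
  have := winj 0 (j - k) n0 ljk k; rewrite addn0 subnKC ?(ltnW kj) //.
  rewrite /w ojk oE => /(_ erefl) /esym /eqP.
  by rewrite subn_eq0 leqNgt kj.
  have adjC x y D : adj (ends I) D x y = adj (ends I) D y x.
  by rewrite /adj setUC.
have fin f : f 0 = root_vertex I -> (forall i, i.+1 < n ->
      adj (ends I) [set~ root_edge I] (f i) (f i.+1)) ->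
    {in [pred i | i < n] &, injective f} -> exists s, numbering s.
  move=> f0 fadj finj; exists (mkseq f n).
  have us : uniq (mkseq f n).
    by rewrite map_inj_in_uniq ?iota_uniq // => i j; rewrite !mem_iota => *; exact: finj.
  split=> //.
  - by rewrite -(prednK n0) /= f0.
  - apply/(sortedP (root_vertex I)) => i; rewrite size_mkseq => li.
    by rewrite !nth_mkseq ?fadj // ltnW.
  move=> x; have cV : #|V| = n by rewrite -(bij_eq_card bv) card_ord.
  have /subset_cardP : #|mkseq f n| = #|V| by rewrite (card_uniqP us) size_mkseq cV.
  by move=> /(_ (subset_predT _)) ->.
have := root_edge_incident I; rewrite -(e'K (root_edge I)) -/k endsE !inE.
have wnk : w (k + n) = v k.
  by rewrite /w -[in RHS](oE k); congr v; apply: val_inj; rewrite /= modnDr.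
have wk1 : w k.+1 = v (ordS k).
  by rewrite /w; congr v; apply: val_inj.
case/orP=> /eqP rE.
- apply: (fin (fun i => w (k + (n - i)))) => [|i li|i j].
  + by rewrite subn0 rE.
  + rewrite adjC -(subnSK (ltnW li)) addnS; apply: adjw.
    by rewrite -[k.+1]addn1 leq_add2l ltn_add2l subn_gt0 li ltn_subrL n0.
  + rewrite !inE => li lj /eqP.
    move: (subnSK li) (subnSK lj) => <- <-; rewrite !addnS -!addSn => /eqP.
    move/winj; rewrite !ltn_subrL n0 => /(_ isT isT) eij.
    apply: succn_inj; rewrite -(subKn li) -(subKn lj) eij //.
- apply: (fin (fun i => w (k.+1 + i))) => [|i li|i j].
  + by rewrite addn0 wk1 rE.
  + rewrite addnS; apply: adjw; rewrite addSn ltnS leq_addr /=.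
    by rewrite -addnS ltn_add2l.
  + by rewrite !inE => li lj; apply: winj.
Qed.

End Wrap.

(* Main.v *)
(* Indexing the vertices along the path (V, E \ {e_r}), the cuts in question are
   the index intervals that avoid the root.  Non-shortenability gives every link
   f of F an interval that f alone covers and that starts right next to the tail
   of f.  If the intervals of two links f and g overlap or are adjacent, their
   union is again an interval, and whatever covers it covers one of the two, so
   it is f or g.  This condition on the four ends and the two intervals already
   forces the uniqueness of in-links, planarity and (iii).  For connectivity: a
   link that enters the hull of the ancestors of an unreachable vertex would
   cross a link between two such ancestors. *)
Require Import Defs.
From mathcomp Require Import all_boot all_order all_algebra.
From mathcomp Require Import reals.
From mathcomp Require Import zify.

Set Implicit Arguments.
Unset Strict Implicit.
Unset Printing Implicit Defensive.

(** The arc is the first one of the walk that leaves [P]. Keeping [connect e t y] shows that both of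
    its ends are ancestors of [y]. *)
Lemma connect_exit (T : finType) (e : rel T) (P : pred T) (x y : T) :
  connect e x y -> P x -> ~~ P y ->
  exists s t, [/\ e s t, connect e t y, P s & ~~ P t].
Proof.
case/connectP=> p; elim: p x => [|z p IHp] x /=; first by move=> _ -> ->.
case/andP=> exz zp yE Px nPy.
have [Pz|nPz] := boolP (P z); first exact: IHp zp yE Pz nPy.
by exists x, z; split=> //; apply/connectP; exists p.
Qed.

(** * Paths and edges of a cycle *)

Section Multigraph.
Variables (V E : finType) (ends : E -> {set V}).

Lemma adjC (D : {set E}) (x y : V) : adj ends D x y = adj ends D y x.
Proof. by rewrite /adj setUC. Qed.

Lemma is_path_iota (D : {set E}) (w : nat -> V) (m : nat) :
  (forall k, k < m -> adj ends D (w k) (w k.+1)) ->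
  {in [pred k | k <= m] &, injective w} ->
  is_path ends D (w 0) [seq w k | k <- iota 1 m] (w m).
Proof.
move=> adjw winj; apply/and3P; split.
- apply/(pathP (w 0)) => k; rewrite size_map size_iota => km.
  rewrite -[_ :: _]/[seq w k | k <- iota 0 m.+1].
  by rewrite !(nth_map 0) ?size_iota ?nth_iota ?add0n ?add1n ?adjw //; lia.
- rewrite last_map; apply/eqP; congr w.
  by case: m {adjw winj} => [|m] //; rewrite -(addn1 m) iotaD last_cat /= addnC.
rewrite -[_ :: _]/[seq w k | k <- iota 0 m.+1] map_inj_in_uniq ?iota_uniq //.
by move=> i j; rewrite !mem_iota => ? ?; apply: winj.
Qed.

Lemma is_path_rev (D : {set E}) (x y : V) (p : seq V) : is_path ends D x p y ->
  exists2 q, is_path ends D y q x & y :: q =i x :: p.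
Proof.
case/and3P=> xp /eqP py up; exists (rev (belast x p)).
  apply/and3P; split.
  - by rewrite -py rev_path (eq_path (e' := adj ends D)) // => ? ?; exact: adjC.
  - by rewrite -py; case: (p) => [|z q] /=; rewrite ?rev_cons ?last_rcons.
  - by rewrite -py -rev_rcons -lastI rev_uniq.
by move=> z; rewrite -py -rev_rcons -lastI mem_rev.
Qed.

Hypothesis cyc : is_cycle ends.

Lemma cycle_card : #|E| = #|V| /\ 1 < #|V|.
Proof.
have [n [v [e [n2 bv be _]]]] := cyc.
by rewrite -(bij_eq_card be) -(bij_eq_card bv) card_ord.
Qed.

Lemma cycle_ends (e : E) : exists x y, ends e = [set x; y].
Proof.
have [n [v [f [_ _ [f' _ f'K] endsE]]]] := cyc.
by exists (v (f' e)), (v (ordS (f' e))); rewrite -endsE f'K.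
Qed.

Lemma cycle_other_edge (z : V) (e : E) : exists2 e', e' != e & z \in ends e'.
Proof.
have [n [v [f [n2 [v' _ v'K] be endsE]]]] := cyc.
set i := v' z; have vi : v i = z by rewrite v'K.
have [fi|fi] := eqVneq (f i) e; last by exists (f i); rewrite // endsE vi set21.
exists (f (ord_pred i)); last by rewrite endsE ord_predK vi set22.
rewrite -fi (inj_eq (bij_inj be)); apply/eqP => /(congr1 val) /=.
case: (i) => -[|j] jn /=; first by rewrite add0n modn_small; lia.
by rewrite modnDr modn_small; lia.
Qed.

End Multigraph.

(** * Indices of vertices and edges along the cycle *)

Section Numbering.
Variables (R : realType) (I : rooted_wrap R) (s : seq (vertex I)).
Hypothesis num_s : numbering s.
Local Notation V := (vertex I).
Local Notation E := (edge I).
Local Notation r := (root_vertex I).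
Local Notation n := (size s).
Local Notation idx x := (index x s).
Local Notation vtx i := (nth r s i).

Let uniq_s : uniq s. Proof. by case: num_s. Qed.

Lemma idx_lt (x : V) : idx x < n.
Proof. by rewrite index_mem; case: num_s. Qed.

Lemma vtxK (i : nat) : i < n -> idx (vtx i) = i.
Proof. by move=> ?; rewrite index_uniq. Qed.

Lemma idxK : cancel (index^~ s) (nth r s).
Proof. by move=> x; rewrite nth_index // -index_mem idx_lt. Qed.

Lemma vtx_eq (i j : nat) : i < n -> j < n -> vtx i = vtx j -> i = j.
Proof. by move=> i_n j_n ij; rewrite -(vtxK i_n) ij vtxK. Qed.

Lemma vtx0 : vtx 0 = r.
Proof. by case: num_s; case: (s) => //= x t [->]. Qed.

Lemma size_numbering : n = #|V|.
Proof.
rewrite -(card_uniqP uniq_s); apply: eq_card => x.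
by rewrite inE; case: num_s => _ _ _ ->.
Qed.

Lemma size_gt1 : 1 < n.
Proof. by rewrite size_numbering; case: (cycle_card (ends_cycle I)). Qed.

Lemma idx_root : idx r = 0.
Proof. by rewrite -vtx0 vtxK // ltnW // size_gt1. Qed.

Lemma idx_gt0 (x : V) : x != r -> 0 < idx x.
Proof.
by rewrite lt0n; apply: contraNneq => x0; rewrite -vtx0 -x0 idxK.
Qed.

Lemma adj_path (i : nat) :
  i.+1 < n -> adj (ends I) [set~ root_edge I] (vtx i) (vtx i.+1).
Proof. by move=> i_n; case: num_s => _ /(sortedP r) /(_ _ i_n). Qed.

(** The numbering yields [n - 1] distinct edges other than the root edge, which takes the last
    index; counting makes this a bijection. The last vertex lies on an edge besides the one before
    it, and only the root edge is left for that. *)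
Lemma edge_numbering : exists2 f : 'I_n -> E,
  bijective f & forall i, ends I (f i) = [set vtx i; vtx (i.+1 %% n)].
Proof.
have n1 := size_gt1; have cyc := ends_cycle I.
have /fin_all_exists[f fP] : forall i : 'I_n, exists e : E,
    (e == root_edge I) = (i.+1 == n) /\
    (i.+1 < n -> ends I e = [set vtx i; vtx i.+1]).
  move=> i.
  have [i_n|n_i] := ltnP i.+1 n.
    have /existsP[e] := adj_path i_n; rewrite !inE => /andP[/negPf e_r /eqP eE].
    by exists e; rewrite e_r; split=> //; apply/esym/negbTE; lia.
  exists (root_edge I); split=> //; rewrite eqxx; have := ltn_ord i; lia.
have finj : injective f.
  move=> i j fij; apply: val_inj => /=.
  have [ri ei] := fP i; have [rj ej] := fP j.
  move: ri; rewrite fij rj; have := ltn_ord i; have := ltn_ord j => j_n i_n.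
  have [iN|iN] := eqVneq i.+1 n; first by move=> /eqP; lia.
  move=> /negbT jN; have i1 : i.+1 < n by lia. have j1 : j.+1 < n by lia.
  have := ei i1; rewrite fij ej // => ijE.
  have : vtx j \in [set vtx i; vtx i.+1] by rewrite -ijE set21.
  have : vtx i \in [set vtx j; vtx j.+1] by rewrite ijE set21.
  rewrite !inE => /orP[] /eqP /vtx_eq ij /orP[] /eqP /vtx_eq ji; lia.
have bf : bijective f.
  by apply: inj_card_bij => //; rewrite card_ord size_numbering; case: (cycle_card cyc) => ->.
exists f => // i; have [ri ei] := fP i.
have [i_n|n_i] := ltnP i.+1 n; first by rewrite modn_small // ei.
have iN : i.+1 = n by have := ltn_ord i; lia.
have i0 : 0 < i by lia.
rewrite iN modnn vtx0.
have jn : i.-1 < n by lia.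
have [e] := cycle_other_edge cyc (vtx i) (f (Ordinal jn)).
have [f' _ f'K] := bf; rewrite -(f'K e) (inj_eq finj); set k := f' e => kj zk.
have ki : k = i.
  have [_ ek] := fP k; have := ltn_ord k => k_n.
  apply: val_inj => /=; have [k1|] := ltnP k.+1 n; last by lia.
  exfalso; move: zk; rewrite ek // !inE => /orP[] /eqP /vtx_eq ik; first lia.
  by move/eqP: kj; apply; apply: val_inj => /=; lia.
move: zk; rewrite ki; move: ri; rewrite iN eqxx => /eqP ->; have := root_edge_incident I.
have [x [y ->]] := cycle_ends cyc (root_edge I); rewrite !inE.
have ir : vtx i != r.
  by apply/eqP => ir; have := idx_root; rewrite -ir vtxK; lia.
by move=> /orP[] /eqP <-; rewrite (negPf ir) ?orbF /= => /eqP <-; rewrite // setUC.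
Qed.

Lemma adj_cycle (i : nat) : i < n -> adj (ends I) [set: E] (vtx i) (vtx (i.+1 %% n)).
Proof.
move=> i_n; have [f _ fE] := edge_numbering.
by apply/existsP; exists (f (Ordinal i_n)); rewrite inE fE eqxx.
Qed.

(** * Cuts and paths of the cycle in terms of indices *)

Definition itv (a b : nat) : {set V} := [set x | a <= idx x <= b].

Lemma card_cutE (C : {set V}) : #|cut (ends I) C| =
  #|[set i : 'I_n | (vtx i \in C) != (vtx (i.+1 %% n) \in C)]|.
Proof.
have [f bf fE] := edge_numbering.
rewrite -(card_imset _ (bij_inj bf)); apply: eq_card => e.
have [f' _ f'K] := bf; rewrite -(f'K e) mem_imset; last exact: bij_inj.
rewrite !inE fE; set x := vtx _; set y := vtx _.
have meet (A : {set V}) : ([set x; y] :&: A != set0) = (x \in A) || (y \in A).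
  apply/set0Pn/orP => [[z]|[zA|zA]]; last 2 first.
  - by exists x; rewrite !inE eqxx.
  - by exists y; rewrite !inE eqxx orbT.
  by rewrite !inE => /andP[/orP[/eqP ->|/eqP ->] ->]; [left|right].
rewrite setDE !meet !inE; by case: (x \in C); case: (y \in C).
Qed.

Lemma itv_min_cut (a b : nat) : 0 < a -> a <= b -> b < n -> itv a b \in min_cuts I.
Proof.
move=> a0 ab bn; rewrite !inE; apply/andP; split.
  by apply/subsetP => x; rewrite !inE; apply: contraTneq => ->; rewrite idx_root; lia.
rewrite card_cutE; have a1n : a.-1 < n by lia.
(* Membership changes from [a - 1] to [a] and from [b] to its successor, which is the root, outside
   the interval, when [b = n - 1]. *)
rewrite (_ : [set _ | _] = [set Ordinal a1n; Ordinal bn]).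
  by rewrite cards2 -val_eqE /=; lia.
apply/setP => i; rewrite !inE -!val_eqE /=.
have i_n := ltn_ord i; rewrite !vtxK ?ltn_mod //; last by lia.
have [iN|iN] := eqVneq i.+1 n; first by rewrite iN modnn; lia.
by rewrite modn_small; lia.
Qed.

(** Take the least and the greatest index occurring in [C]. Membership changes just before the one
    and just after the other; a cut of size 2 leaves no third change, hence no gap. *)
Lemma min_cut_itv (C : {set V}) : C \in min_cuts I ->
  exists a b, [/\ 0 < a, a <= b, b < n & C = itv a b].
Proof.
rewrite inE card_cutE => /andP[/subsetP Cr /cards2P[i0 [j0 [_ ijE]]]].
have C0 : exists x, x \in C.
  apply/set0Pn; apply: contra_eqT ijE => /negPn/eqP ->.
  by apply/eqP => /setP /(_ i0); rewrite !inE !eqxx.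
have [x0 x0C] := C0.
case: (arg_minnP (index^~ s) x0C) => p pC pmin; case: (arg_maxnP (index^~ s) x0C) => q qC qmax.
have {}pC : p \in C by []. have {}qC : q \in C by [].
have p0 : 0 < idx p by apply: idx_gt0; move/Cr: pC; rewrite !inE.
have pq : idx p <= idx q by exact: pmin.
have ip := idx_lt p; have iq := idx_lt q.
exists (idx p), (idx q); split=> //.
have n0 : 0 < n by lia.
have lowP i : i < n -> i < idx p -> vtx i \notin C.
  by move=> i_n ip'; apply/negP => /pmin; rewrite vtxK //; lia.
have highP i : i < n -> idx q < i -> vtx i \notin C.
  by move=> i_n iq'; apply/negP => /qmax; rewrite /= vtxK //; lia.
have p1n : (idx p).-1 < n by lia.
have p_in : Ordinal p1n \in [set i : 'I_n | (vtx i \in C) != (vtx (i.+1 %% n) \in C)].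
  rewrite inE /= prednK // modn_small // idxK pC (negPf (lowP _ _ _)) //; lia.
have q_in : Ordinal iq \in [set i : 'I_n | (vtx i \in C) != (vtx (i.+1 %% n) \in C)].
  rewrite inE /= idxK qC.
  have [qN|qN] := eqVneq (idx q).+1 n; first by rewrite qN modnn (negPf (lowP _ _ _)).
  by rewrite modn_small ?(negPf (highP _ _ _)) //; lia.
have mid i : idx p <= i <= idx q -> vtx i \in C.
  elim: i => [|i IHi] /andP[pi iq']; first by lia.
  have [<-|pi'] := eqVneq (idx p) i.+1; first by rewrite idxK.
  have i_n : i < n by lia.
  have iC : vtx i \in C by apply: IHi; lia.
  have : Ordinal i_n \notin [set i : 'I_n | (vtx i \in C) != (vtx (i.+1 %% n) \in C)].
    move: p_in q_in; rewrite ijE !inE -!val_eqE /=; lia.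
  by rewrite inE /= iC modn_small 1?negbK => [/eqP <-|]; lia.
apply/setP => x; rewrite inE; apply/idP/idP => [xC|/mid]; last by rewrite idxK.
by apply/andP; split; [exact: pmin|exact: qmax].
Qed.

(* The path walks in the direction of increasing index, and through [e_r] when
   [y] comes before [x]. *)
Lemma path_up (D : {set E}) (x y : V) :
  (forall k, k.+1 < n -> adj (ends I) D (vtx k) (vtx k.+1)) ->
  idx x <= idx y \/ adj (ends I) D (vtx n.-1) (vtx 0) ->
  exists2 p, is_path (ends I) D x p y & forall z,
    (z \in x :: p) = if idx x <= idx y then idx x <= idx z <= idx y
                     else (idx x <= idx z) || (idx z <= idx y).
Proof.
move=> adjD wrap; have xn := idx_lt x; have yn := idx_lt y.
(* [g k] is the index reached after [k] steps and [m] the number of steps. One subtraction of [n]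
   suffices, as the walk never closes up. *)
pose g k := if idx x + k < n then idx x + k else idx x + k - n.
pose m := if idx x <= idx y then idx y - idx x else idx y + n - idx x.
have gn k : k <= m -> g k < n by rewrite /g /m; do 2 case: ifP; lia.
exists [seq vtx (g k) | k <- iota 1 m].
  have {1}-> : x = vtx (g 0) by rewrite /g addn0 xn idxK.
  have {1}-> : y = vtx (g m).
    by rewrite -[LHS]idxK; congr nth; rewrite /g /m; do 2 case: ifP; lia.
  apply: (@is_path_iota _ _ _ _ (fun k => vtx (g k))) => [k km|i j].
    have := gn k; have := gn k.+1; rewrite /g.
    case: ifP; case: ifP => // c1 c2 l1 l2; rewrite ?addnS.
    - by apply: adjD; lia.
    - by exfalso; lia.
    - case: wrap => [xy|]; first by move: km; rewrite /m xy; lia.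
      by congr adj; congr nth; lia.
    - by rewrite subSn; [apply: adjD; lia|lia].
  rewrite !inE => im jm /vtx_eq; move/(_ (gn _ im) (gn _ jm)).
  move: im jm; rewrite /g /m; do 3 case: ifP; lia.
move=> z; have zn := idx_lt z.
have {1}-> : x = vtx (g 0) by rewrite /g addn0 xn idxK.
rewrite -[_ :: _]/[seq vtx (g k) | k <- iota 0 m.+1].
apply/mapP/idP => [[k]|zP].
  rewrite mem_iota => /andP[_ km] ->; rewrite vtxK ?gn //.
  by move: km; rewrite /g /m; do 2 case: ifP; lia.
exists (if idx x <= idx z then idx z - idx x else idx z + n - idx x).
  by rewrite mem_iota; move: zP; rewrite /m; do 2 case: ifP; lia.
by rewrite -[LHS]idxK; congr nth; rewrite /g; do 2 case: ifP; lia.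
Qed.

(** * Crossing and shortening in terms of indices *)

Definition separates (x y z : V) : bool :=
  (idx x < idx z < idx y) || (idx y < idx z < idx x).

(** The two arcs between [a] and [b] are the upward walk from [a] and the reversed upward walk from
    [b]. One carries the indices between the two ends, the other the remaining ones, so [x] and [y]
    cannot both avoid an arc. *)
Lemma cross_separates (a b x y : V) : cross (ends I) a b x y ->
  [/\ idx a != idx b, idx x != idx a, idx x != idx b,
      idx y != idx a & idx y != idx b] /\ separates a b x != separates a b y.
Proof.
have ne (u v : V) : (idx u != idx v) = (u != v) by rewrite (can_eq idxK).
have wrap : adj (ends I) [set: E] (vtx n.-1) (vtx 0).
  have n1 := size_gt1; have := @adj_cycle n.-1; rewrite prednK ?modnn; last by lia.
  by apply; lia.
have adjT k : k.+1 < n -> adj (ends I) [set: E] (vtx k) (vtx k.+1).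
  by move=> kn; have := @adj_cycle k; rewrite modn_small //; apply; lia.
case; rewrite disjoint_sym => /disjointFr dis.
have := dis x; rewrite !inE eqxx => /(_ isT) /norP[xa xb].
have := dis y; rewrite !inE eqxx orbT => /(_ isT) /norP[ya yb] meet.
move: xa xb ya yb; rewrite -!ne => xa xb ya yb.
have [p ab pE] := path_up adjT (or_intror wrap) (x := a) (y := b).
have [q ba qE] := path_up adjT (or_intror wrap) (x := b) (y := a).
have [q' /meet ab' q'E] := is_path_rev ba.
move/meet: ab; move: ab'; rewrite !q'E !pE !qE /separates.
move: xa xb ya yb; do 2 case: ifP; split; try split; lia.
Qed.

Lemma path_between (x y z : V) : idx x <= idx z <= idx y \/ idx y <= idx z <= idx x ->
  exists2 p, is_path (ends I) [set~ root_edge I] x p y & z \in x :: p.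
Proof.
case=> zP; have := zP => /andP[xz zy]; have xy := leq_trans xz zy.
  have [p pP pE] := path_up adj_path (or_introl xy).
  by exists p; rewrite // pE xy.
have [p /is_path_rev[q qP qE] pE] := path_up adj_path (or_introl xy).
by exists q; rewrite // qE pE xy.
Qed.

(** * Private intervals of links *)

Variable F : {set V * V}.
Hypothesis hF : non_shortenable F.

Lemma solution_itv (a b : nat) : 0 < a -> a <= b -> b < n ->
  exists2 f, f \in F & (a <= idx f.2 <= b) && ~~ (a <= idx f.1 <= b).
Proof.
case: hF => sol _ _ a0 ab bn; have [f fF] := sol _ (itv_min_cut a0 ab bn).
by rewrite /covers !inE => fC; exists f.
Qed.

Lemma not_solution (G : {set V * V}) : ~ directed_solution G ->
  exists2 C, C \in min_cuts I & forall g, g \in G -> ~~ covers g C.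
Proof.
move=> nG; have [/exists_inP[C CI /forall_inP CG]|no] :=
  boolP [exists C in min_cuts I, [forall g in G, ~~ covers g C]]; first by exists C.
case: nG => C CI; have := no; rewrite negb_exists_in => /forall_inP/(_ C CI).
by rewrite negb_forall_in => /exists_inP[f fG /negPn fC]; exists f.
Qed.

(** Move the tail of [f] one vertex towards the head. This strict shortening leaves some cut
    uncovered, which only [f] covered. The new link has its head in that cut, so its tail is there
    too, and the cut begins right beside the old tail. If the moved tail would be the head itself,
    deletion of [f] takes the place of the shortening. *)
Lemma private_itv (f : V * V) : f \in F ->
  exists a b, [/\ 0 < a, b < n, a <= idx f.2 <= b,
    (idx f.1).+1 = a \/ idx f.1 = b.+1
    & forall g, g \in F -> a <= idx g.2 <= b -> ~~ (a <= idx g.1 <= b) -> g = f].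
Proof.
case: f => u v fF; have [sol del short] := hF.
have un := idx_lt u; have vn := idx_lt v.
have private C : C \in min_cuts I -> (forall g, g \in F :\ (u, v) -> ~~ covers g C) ->
    covers (u, v) C /\ forall g, g \in F -> covers g C -> g = (u, v).
  move=> CI nC; have prv g : g \in F -> covers g C -> g = (u, v).
    by move=> gF gC; apply/eqP; apply: contraLR gC => guv; apply: nC; rewrite !inE guv.
  by split=> //; have [g gF gC] := sol C CI; rewrite -(prv g gF gC).
(* A loop covers no cut, so it could be deleted. *)
have uv : idx u != idx v.
  have [C CI /(private C CI)[fC _]] := not_solution (del _ fF).
  by rewrite (can_eq idxK); apply: contraTneq fC => ->; rewrite /covers /= andbN.
pose i := if idx u < idx v then (idx u).+1 else (idx u).-1.
have i_n : i < n by rewrite /i; case: ifP; lia.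
have [C [CI iC [fC prv]]] : exists C, [/\ C \in min_cuts I, vtx i \in C &
    covers (u, v) C /\ forall g, g \in F -> covers g C -> g = (u, v)].
  have [iv|iv] := eqVneq (vtx i) v.
    have [C CI /(private C CI) fC] := not_solution (del _ fF).
    by exists C; split=> //; rewrite iv; case: fC => /andP[].
  have [|C CI nC] := not_solution (short (u, v) (vtx i, v) fF _).
    split=> /=; last first.
      by rewrite -(can_eq idxK) vtxK // /i; case: ifP; lia.
    split=> //=; apply: path_between; rewrite vtxK // /i.
    by case: ifP; lia.
  have fC : covers (u, v) C /\ forall g, g \in F -> covers g C -> g = (u, v).
    by apply: private => // g gF; apply: nC; rewrite setU1r.
  exists C; split=> //; case: fC => /andP[/= vC _] _.
  by have := nC _ (setU11 _ _); rewrite /covers /= vC /= negbK.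
have [a [b [a0 ab bn CE]]] := min_cut_itv CI.
move: iC fC; rewrite /covers CE !inE /= vtxK // => iC /andP[vC uC].
exists a, b; split=> //; first by move: iC; rewrite /i; case: ifP; lia.
by move=> g gF g2 g1; apply: prv => //; rewrite /covers CE !inE g2 g1.
Qed.

(** Reduces the interplay of two links to linear arithmetic on indices. The [.+1] admits intervals
    that merely touch. *)
Lemma private_itv2 (f g : V * V) : f \in F -> g \in F -> f != g ->
  exists a b c d,
    [/\ a <= idx f.2 <= b, (idx f.1).+1 = a \/ idx f.1 = b.+1,
        c <= idx g.2 <= d, (idx g.1).+1 = c \/ idx g.1 = d.+1 &
        [/\ c <= idx f.2 <= d -> c <= idx f.1 <= d,
            a <= idx g.2 <= b -> a <= idx g.1 <= b &
            maxn a c <= (minn b d).+1 ->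
              ~~ (minn a c <= idx f.1 <= maxn b d) \/
              ~~ (minn a c <= idx g.1 <= maxn b d)]].
Proof.
move=> fF gF fg; have [a [b [a0 bn f2 f1 fP]]] := private_itv fF.
have [c [d [c0 dn g2 g1 gP]]] := private_itv gF.
exists a, b, c, d; split=> //; split.
- by move=> f2'; apply: contraNT fg => /(gP _ fF f2') ->.
- by move=> g2'; apply: contraNT fg => /(fP _ gF g2') ->.
(* [h] covers the union: its head lies in one interval and its tail in neither, so it is [f] or
   [g]. *)
move=> abcd; have [||| h hF' /andP[h2 h1]] := @solution_itv (minn a c) (maxn b d); try lia.
have [h2'|h2'] := boolP (a <= idx h.2 <= b).
  by left; rewrite -(fP h) //; lia.
by right; rewrite -(gP h) //; lia.
Qed.

(** * Pairs of links and reachability *)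

(** With a common head, each tail must lie in the private interval of the other link. The union then
    contains both tails, a contradiction. *)
Lemma head_inj (f g : V * V) : f \in F -> g \in F -> f.2 = g.2 -> f = g.
Proof.
move=> fF gF fg2; apply/eqP; apply/negPn/negP.
case/(private_itv2 fF gF) => a [b [c [d []]]]; rewrite fg2.
by move=> h1 h2 h3 h4 [h5 h6 h7]; lia.
Qed.

(** Both private intervals begin at the same neighbour of the common tail, so they are nested, and
    both links cover the larger one. *)
Lemma tail_same_side (f g : V * V) : f \in F -> g \in F -> f.1 = g.1 ->
  (idx f.1 < idx f.2) = (idx f.1 < idx g.2) -> f = g.
Proof.
move=> fF gF fg1 side; apply/eqP; apply/negPn/negP.
case/(private_itv2 fF gF) => a [b [c [d []]]]; move: side; rewrite fg1.
by move=> h0 h1 h2 h3 h4 [h5 h6 h7]; lia.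
Qed.

(** A private interval contains everything from beside the tail up to the head. If the links
    crossed, either one would cover the private interval of the other, or the intervals would
    overlap or touch and their union would contain both tails. *)
Lemma noncrossing (f g : V * V) : f \in F -> g \in F ->
  idx g.1 != idx f.1 -> idx g.1 != idx f.2 -> idx g.2 != idx f.1 ->
  idx g.2 != idx f.2 -> separates f.1 f.2 g.1 = separates f.1 f.2 g.2.
Proof.
move=> fF gF n1 n2 n3 n4.
have fg : f != g by apply: contraNneq n1 => ->.
have [a [b [c [d []]]]] := private_itv2 fF gF fg.
rewrite /separates => h1 h2 h3 h4 [h5 h6 h7]; lia.
Qed.

Lemma root_connect (v : V) : connect (fun x y => (x, y) \in F) r v.
Proof.
set e := fun _ _ => _; apply/negPn/negP => nrv.
pose A := [pred x | connect e x v].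
have vA : v \in A by rewrite inE connect0.
case: (arg_minnP (index^~ s) vA) => p pA pmin; case: (arg_maxnP (index^~ s) vA) => q qA qmax.
have p0 : 0 < idx p.
  by apply: idx_gt0; apply: contraNneq nrv => <-.
(* The hull of the ancestors avoids the root, so a link enters it. Its head [y] is no ancestor,
   since otherwise [x] would be one and lie in the hull. *)
have [|[x y] xyF /= /andP[yP xP]] := solution_itv p0 _ (idx_lt q); first exact: pmin.
have yA : y \notin A.
  apply: contraNN xP => yA; have xA : x \in A.
    by apply: connect_trans yA; apply: connect1.
  by apply/andP; split; [exact: pmin|exact: qmax].
have neA z : z \in A -> idx z != idx y.
  by move=> zA; rewrite (can_eq idxK); apply: contraNneq yA => <-.
have vpq : idx p <= idx v <= idx q by apply/andP; split; [exact: pmin|exact: qmax].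
(* Such a link has [y] strictly between its ends but not [x], which is outside the hull; so it
   crosses [(x, y)]. *)
suff [s' [t [st [sA tA] st_y]]] : exists s' t, [/\ (s', t) \in F, s' \in A /\ t \in A &
    (idx s' < idx y < idx t) || (idx t < idx y < idx s')].
  have := noncrossing st xyF; rewrite /separates /= st_y.
  have := pmin _ sA; have := pmin _ tA; have := qmax _ sA; have := qmax _ tA.
  rewrite /=; lia.
have vy := neA _ vA; have py := neA _ pA; have qy := neA _ qA.
(* The walk to [v] from the end of the hull beyond [y] runs through ancestors only, so it must jump
   over [y]. *)
have [vy'|yv] := ltnP (idx v) (idx y).
- have [||s' [t [st tv ys]]] := @connect_exit _ e (fun z => idx y < idx z) _ _ qA.
  + by lia.
  + by lia.
  have sA : s' \in A by apply: connect_trans tv; apply: connect1.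
  by exists s', t; split=> //; have := neA _ tv; lia.
have [||s' [t [st tv ys]]] := @connect_exit _ e (fun z => idx z < idx y) _ _ pA.
+ by lia.
+ by lia.
have sA : s' \in A by apply: connect_trans tv; apply: connect1.
by exists s', t; split=> //; have := neA _ tv; lia.
Qed.

End Numbering.

Theorem theorem7 (R : realType) (I : rooted_wrap R)
    (F : {set vertex I * vertex I}) (hF : non_shortenable F) :
  [/\ is_arborescence F (root_vertex I),
      planar (ends I) F
    & forall s : seq (vertex I), numbering s ->
      forall v : vertex I,
        #|[set f in out_links F v | left_going s f]| <= 1 /\
        #|[set f in out_links F v | right_going s f]| <= 1].
Proof.
(* The first two claims mention no numbering, so any one serves. *)
have [s num_s] := numbering_exists I; split.
- split=> [|v vr|v]; last exact: (root_connect num_s hF).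
  (* The private interval of a link into the root would contain index 0. *)
  + apply/eqP; rewrite cards_eq0; apply/eqP/setP => f; rewrite !inE.
    apply/negP => /andP[fF /eqP f2]; have [a [b [a0 _]]] := private_itv num_s hF fF.
    by rewrite f2 idx_root //; lia.
  + have v0 := idx_gt0 num_s vr.
    (* Some link must enter the one-vertex interval at [v]. *)
    have [f fF /andP[fv _]] := solution_itv num_s hF v0 (leqnn _) (idx_lt num_s v).
    have f2 : f.2 = v by apply: (can_inj (idxK num_s)); lia.
    apply/eqP/cards1P; exists f; apply/setP => g; rewrite !inE.
    apply/andP/eqP => [[gF /eqP g2]|->]; last by rewrite fF f2.
    by apply: (head_inj num_s hF) => //; rewrite g2.
- move=> f g fF gF /(cross_separates num_s)[[_ n1 n2 n3 n4]] /negP; apply; apply/eqP.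
  exact: (noncrossing num_s hF fF gF n1 n2 n3 n4).
move=> s' num_s' v; split; apply/card_le1_eqP => f g; rewrite !inE;
  rewrite /left_going /right_going => /andP[/andP[fF /eqP f1] fs] /andP[/andP[gF /eqP g1] gs];
  apply: (tail_same_side num_s' hF) => //; rewrite ?g1 //; move: fs gs; rewrite f1 g1; lia.
Qed.
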